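(* Let $d\geq1$, $M\in\mathbb{N}_{\geq2}$, $p\in(1/M,1]$, let $F$ be the fractal percolation in $[0,1]^d$ with parameters $M,p$, $D=\log(M^dp)/\log M$, $r=1/M$, and let $C_n$ and $C_n^j$ be as in the context. Then for each $k\in\{0,\ldots,d\}$ with $k<D$ the limit $$\overline{\mathcal V}^c_k(F):=\lim_{n\to\infty} r^{n(D-k)}\mathbb{E}V_k(C_n)$$ exists and equals $$q_{d,k}\frac{M^{d-k}(1-p)}{M^{d-k}p-1}+\sum_{T\subset\{1,\ldots,M^d\},\,|T|\geq2}(-1)^{|T|-1}\sum_{n=1}^\infty r^{n(D-k)}\mathbb{E}V_k\Big(\bigcap_{j\in T}C_n^j\Big),$$ where $q_{d,k}=V_k([0,1]^d)$ and all series converge.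
   Context: Fractal percolation: $J=[0,1]^d$, $F_0:=J$; given $F_{n-1}$, a union of closed grid cubes of side $M^{-(n-1)}$, each such cube is divided into $M^d$ closed subcubes of side $M^{-n}$, each kept independently (of everything else) with probability $p$; $F_n$ is the union of kept subcubes. $J_1,\ldots,J_{M^d}$ are the closed subcubes of side $1/M$ of $J$. $C_n:=\overline{J\setminus F_n}$ (closure), which is the union of all level-$n$ grid cubes (side $M^{-n}$) not belonging to $F_n$; $C_n^j$ is the union of those level-$n$ grid cubes contained in $J_j$ that do not belong to $F_n$. $V_k$ denote intrinsic volumes, additively extended to finite unions of compact convex sets, $V_k(\emptyset)=0$. *)

(* Defs.v *)
From HB Require Import structures.
From mathcomp Require Import all_boot all_order all_algebra.
From mathcomp Require Import all_classical all_reals all_analysis.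
Set Implicit Arguments. Unset Strict Implicit. Unset Printing Implicit Defensive.
Import Order.TTheory GRing.Theory Num.Theory.
Local Open Scope classical_set_scope.
Local Open Scope ring_scope.

Section FP.
Variable R : realType.
Variable d : nat.

Definition pt := 'I_d -> R.

Definition box_set (lo hi : pt) : set pt :=
  [set x | forall i, lo i <= x i <= hi i].

Definition esym_sides (k : nat) (lo hi : pt) : R :=
  \sum_(S : {set 'I_d} | #|S| == k) \prod_(i in S) (hi i - lo i).

Definition is_box (B : set pt) : Prop :=
  exists lh : pt * pt, (forall i, lh.1 i <= lh.2 i) /\ B = box_set lh.1 lh.2.

(* intrinsic volume V_k of a (possibly empty) box:
   V_k([lo,hi]) = e_k(hi_1-lo_1,...,hi_d-lo_d), V_k(empty)=0 *)
Definition Vbox (k : nat) (B : set pt) : R :=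
  match pselect (is_box B) with
  | left h => let lh := projT1 (cid h) in esym_sides k lh.1 lh.2
  | right _ => 0
  end.

Definition box_family := {m : nat & 'I_m -> set pt}.

Definition represents (A : set pt) (Q : box_family) : Prop :=
  (forall i, is_box (projT2 Q i)) /\ A = \bigcup_i projT2 Q i.

Definition Vk_fam (k : nat) (Q : box_family) : R :=
  \sum_(S : {set 'I_(projT1 Q)} | S != finset.set0)
     (-1) ^+ (#|S|.-1) * Vbox k (\bigcap_(i in [set i | i \in S]) projT2 Q i).

(* additive extension of V_k to finite unions of boxes
   (computed through any representation); 0 on other sets *)
Definition Vk (k : nat) (A : set pt) : R :=
  match pselect (exists Q, represents A Q) with
  | left h => Vk_fam k (projT1 (cid h))
  | right _ => 0
  end.

Variable M : nat.

Definition cube (m : nat) : finType := {ffun 'I_d -> 'I_(M ^ m)}.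

Definition cube_set (m : nat) (x : cube m) : set pt :=
  box_set (fun i => (x i)%:R / (M ^ m)%:R) (fun i => (x i).+1%:R / (M ^ m)%:R).

(* the random coins deciding survival of every grid cube of levels 1..n *)
Definition coins (n : nat) : finType :=
  {ffun {m : 'I_n & cube m.+1} -> bool}.

Definition is_anc (n : nat) (t : {m : 'I_n & cube m.+1}) (x : cube n) : bool :=
  [forall i, val (tagged t i) == (val (x i) %/ M ^ (n - (tag t).+1))%N].

Definition kept (n : nat) (w : coins n) (x : cube n) : bool :=
  [forall t, is_anc t x ==> w t].

Definition weight (p : R) (n : nat) (w : coins n) : R :=
  \prod_t (if w t then p else 1 - p).

Definition Expect (p : R) (n : nat) (f : coins n -> R) : R :=
  \sum_(w : coins n) weight p w * f w.

Definition Cn (n : nat) (w : coins n) : set pt :=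
  \bigcup_(x in [set x : cube n | ~~ kept w x]) cube_set x.

Definition Cnj (n : nat) (w : coins n) (j : cube 1) : set pt :=
  \bigcup_(x in [set x : cube n | ~~ kept w x /\
                 forall i, (val (x i) %/ M ^ n.-1)%N = val (j i)]) cube_set x.

Definition Dim (p : R) : R := ln ((M%:R) ^+ d * p) / ln (M%:R).
Definition rr : R := (M%:R)^-1.

End FP.

(* Main.v *)
Require Import Defs.
From HB Require Import structures.
From mathcomp Require Import all_boot all_order all_algebra zify ring lra.
From mathcomp Require Import all_classical all_reals all_analysis.
Import Order.TTheory GRing.Theory Num.Theory.
Import numFieldNormedType.Exports.
Local Open Scope classical_set_scope.
Local Open Scope ring_scope.

(** The sets [C_n^j] cover [C_n], so inclusion-exclusion expresses [V_k(C_n)]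
    through the intersections of the [C_n^j]. Conditionally on the first coin
    of [J_j], the set [C_n^j] is either all of [J_j] or a copy of [C_(n-1)]
    scaled by [1/M]; hence [e_n = E V_k(C_n)] satisfies
    [e_(n+1) = lambda e_n + M^(d-k) (1-p) q + (terms with |T| >= 2)] with
    [lambda = M^(d-k) p = r^(k-D) > 1], and multiplying by [lambda^-(n+1)] and
    telescoping gives the formula.

    The series converge because for [|T| >= 2] the intersection lies in a
    hyperplane: it consists of [O(M^((d-1)n))] relatively open faces of the
    grid, each contributing [O(M^(-kn))] to [V_k], so that the [n]-th term is
    [O((Mp)^-n)], and [Mp > 1].

    Both this estimate and the independence of [V_k] of the representation rest
    on writing [V_k] as a finite weighted sum over the relatively open cells of
    a product grid: a cell with [m] open sides has weight [(-1)^(m-k)] times the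
    [k]-th elementary symmetric polynomial of these sides. *)

Set Implicit Arguments. Unset Strict Implicit. Unset Printing Implicit Defensive.

(** * Cell decomposition of boxes *)

Section Cells.
Variable R : realType.
Implicit Types (s : seq R) (a b x y : R).

(* [(x, (e, l))]: sample point, Euler characteristic and length of a relatively
   open cell of the partition of [[min s, max s]] by [s]. *)
Fixpoint cells s : seq (R * (R * R)) :=
  if s is x :: s' then
    (x, (1, 0)) ::
      (if s' is y :: _ then ((x + y) / 2, (-1, y - x)) :: cells s' else [::])
  else [::].

Lemma path_cells x s : path <%R x s ->
  path <%R x (behead (unzip1 (cells (x :: s)))).
Proof.
elim: s x => [//|y s IH] x /= /andP[xy ys].
have := IH y ys => /= ->; rewrite andbT; apply/andP; split; lra.
Qed.

Lemma sorted_cells s : sorted <%R s -> sorted <%R (unzip1 (cells s)).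
Proof. by case: s => [//|x s] /path_cells. Qed.

Lemma cells_ge x s c : path <%R x s -> c \in cells (x :: s) -> x <= c.1.
Proof.
move=> /path_cells xs /(map_f fst); rewrite -/(unzip1 _) /= inE.
case/predU1P => [->//|cs]; apply: ltW.
by move/(order_path_min lt_trans): xs => /allP /(_ _ cs).
Qed.

Definition Iab a b x : R := (a <= x <= b)%R%:R.

Lemma Iab_in a b x : a <= x -> x <= b -> Iab a b x = 1.
Proof. by rewrite /Iab => -> ->. Qed.

Lemma Iab_lt a b x : x < a -> Iab a b x = 0.
Proof. by rewrite /Iab ltNge => /negbTE ->. Qed.

Lemma Iab_gt a b x : b < x -> Iab a b x = 0.
Proof. by rewrite /Iab ltNge => /negbTE ->; rewrite andbF. Qed.

(** This and the next definition integrate against the Euler characteristic and against length. One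
    sample per cell suffices for functions constant on cells, such as indicators of segments with
    ends in [s]. *)
Definition euler_cells s (f : R -> R) : R := \sum_(c <- cells s) c.2.1 * f c.1.
Definition length_cells s (f : R -> R) : R := \sum_(c <- cells s) c.2.2 * f c.1.

Lemma euler_cells_cons2 x y s f : euler_cells [:: x, y & s] f =
  f x - f ((x + y) / 2) + euler_cells (y :: s) f.
Proof. by rewrite /euler_cells [cells _]/= 2!big_cons /= mul1r mulN1r addrA. Qed.

Lemma length_cells_cons2 x y s f : length_cells [:: x, y & s] f =
  (y - x) * f ((x + y) / 2) + length_cells (y :: s) f.
Proof. by rewrite /length_cells [cells _]/= 2!big_cons /= mul0r add0r. Qed.

Lemma cells_Iab0 x s a b : path <%R x s -> b < x ->
  euler_cells (x :: s) (Iab a b) = 0 /\ length_cells (x :: s) (Iab a b) = 0.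
Proof.
move=> xs bx; rewrite /euler_cells /length_cells !big_seq.
by split; rewrite big1// => c /(cells_ge xs) xc;
  rewrite Iab_gt ?mulr0// (lt_le_trans bx).
Qed.

Lemma path_lt_ge x s y : path <%R x s -> y \in x :: s -> x <= y.
Proof.
move=> xs; rewrite inE => /predU1P[->//|ys]; apply/ltW.
by move/(order_path_min lt_trans): xs => /allP /(_ _ ys).
Qed.

(** Allowing [a <= x] rather than [a = x] keeps the claim stable when [x] is removed: the point [x]
    and the open edge after it cancel in the Euler characteristic, and that edge adds its length. *)
Lemma cells_Iab_left x s a b : path <%R x s -> a <= x -> b \in x :: s ->
  euler_cells (x :: s) (Iab a b) = 1 /\ length_cells (x :: s) (Iab a b) = b - x.
Proof.
elim: s x => [|y s IH] x.
  move=> _ ax; rewrite inE => /eqP ->.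
  by rewrite /euler_cells /length_cells /= !big_seq1 /= Iab_in//; lra.
move=> xs ax; rewrite inE; have /andP[xy ys] : (x < y) && path <%R y s := xs.
rewrite euler_cells_cons2 length_cells_cons2; case/predU1P => [->|bs].
  have [-> ->] := cells_Iab0 a ys xy.
  by rewrite Iab_in// Iab_gt; lra.
have yb := path_lt_ge ys bs.
have [|-> ->] := IH y ys _ bs; first lra.
rewrite !Iab_in; lra.
Qed.

Lemma cells_Iab s a b : sorted <%R s -> a \in s -> b \in s -> a <= b ->
  euler_cells s (Iab a b) = 1 /\ length_cells s (Iab a b) = b - a.
Proof.
elim: s => [//|x s IH] xs.
rewrite inE => /predU1P[->|]; first by move=> bs xb; exact: cells_Iab_left.
case: s IH xs => [//|y s] IH /andP[xy ys] asy bsy ab.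
have ya := path_lt_ge ys asy.
have bys : b \in y :: s.
  by move: bsy; rewrite inE => /predU1P[bx|//]; lra.
have [e l] := IH ys asy bys ab.
rewrite euler_cells_cons2 length_cells_cons2 e l !(@Iab_lt a b); lra.
Qed.

End Cells.

(** * Grid functionals and inclusion-exclusion for indicators *)

Section GridFunctional.
Variables (R : realType) (d : nat).
Implicit Types (s : seq R) (f : pt R d -> R).

Definition cell s i : R * (R * R) := nth (0, (0, 0)) (cells s) i.

Definition grid_index s : finType := {ffun 'I_d -> 'I_(size (cells s))}.

Definition grid_pt s (c : grid_index s) : pt R d := fun i => (cell s (c i)).1.

(** A product of length along [S] and Euler characteristic along the other coordinates. Points have
    length 0, so summing over [#|S| = k] gives a cell with [m] open sides the weight [(-1)^(m-k)]
    times the [k]-th elementary symmetric polynomial of these sides. *)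
Definition grid_weight s (S : {set 'I_d}) (c : grid_index s) : R :=
  \prod_i (if i \in S then (cell s (c i)).2.2 else (cell s (c i)).2.1).

Definition Lk s k f : R :=
  \sum_(S : {set 'I_d} | #|S| == k)
    \sum_(c : grid_index s) grid_weight S c * f (grid_pt c).

Lemma sum_cell s (u : R * (R * R) -> R) :
  \sum_(i < size (cells s)) u (cell s i) = \sum_(c <- cells s) u c.
Proof. by rewrite (big_nth (0, (0, 0))) big_mkord. Qed.

Lemma indic_box (lo hi x : pt R d) :
  \1_(box_set lo hi) x = \prod_i Iab (lo i) (hi i) (x i) :> R.
Proof.
rewrite indicE /Iab; case: (boolP (x \in _)) => [|].
  by rewrite inE => h; rewrite big1// => i _; rewrite h.
rewrite notin_setE => /existsNP[i] /negP /negbTE h.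
by rewrite (bigD1 i)//= h mul0r.
Qed.

(** The indicator of a box is a product of functions of one coordinate, so the sum over cells
    factors: coordinates in [S] give the side length, the others give 1. *)
Lemma Lk_box s k lo hi : sorted <%R s ->
  (forall i, lo i \in s) -> (forall i, hi i \in s) ->
  (forall i, lo i <= hi i) ->
  Lk s k \1_(box_set lo hi) = esym_sides k lo hi.
Proof.
move=> ss los his lohi; apply: eq_bigr => S _.
transitivity (\prod_i (\sum_(t < size (cells s))
    (if i \in S then (cell s t).2.2 else (cell s t).2.1) *
    Iab (lo i) (hi i) (cell s t).1)).
  rewrite bigA_distr_bigA; apply: eq_bigr => c _.
  by rewrite indic_box -big_split.
rewrite [RHS]big_mkcond; apply: eq_bigr => i _.
have [e l] := cells_Iab ss (los i) (his i) (lohi i).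
case: ifP => _.
  by rewrite -l /length_cells -(sum_cell s (fun c => c.2.2 * _ c.1)).
by rewrite -e /euler_cells -(sum_cell s (fun c => c.2.1 * _ c.1)).
Qed.

Lemma Lk_sum s k (I : finType) (P : pred I) (e : I -> R) (F : I -> pt R d -> R) f :
  (forall x, f x = \sum_(i | P i) e i * F i x) ->
  Lk s k f = \sum_(i | P i) e i * Lk s k (F i).
Proof.
move=> fE; rewrite /Lk.
under [RHS]eq_bigr do rewrite mulr_sumr.
rewrite [RHS]exchange_big /=; apply: eq_bigr => S _.
under [RHS]eq_bigr do rewrite mulr_sumr.
rewrite [RHS]exchange_big /=; apply: eq_bigr => c _.
by rewrite fE mulr_sumr; apply: eq_bigr => i _; rewrite mulrCA.
Qed.

Lemma Lk0 s k : Lk s k \1_set0 = 0.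
Proof.
by rewrite /Lk big1// => S _; rewrite big1// => c _; rewrite indic0 mulr0.
Qed.

End GridFunctional.

(** Expand [1 - \prod_i (1 - 1_(A i))]. The products are formed in [int] and then cast, because the
    target ring may be noncommutative. *)
Lemma indic_inclusion_exclusion (R : pzRingType) (T : Type) (I : finType)
    (A : I -> set T) (x : T) :
  \1_(\bigcup_i A i) x = \sum_(S : {set I} | S != finset.set0)
    (-1) ^+ (#|S|.-1) * \1_(\bigcap_(i in [set i | i \in S]) A i) x :> R.
Proof.
have capE (S : {set I}) : \1_(\bigcap_(i in [set i | i \in S]) A i) x =
    (\prod_(i in S) (x \in A i)%:R : int)%:~R :> R.
  rewrite indicE; case: (boolP (x \in _)) => [|].
    rewrite inE => h; rewrite big1// => i iS.
    by rewrite mem_set//; exact: h.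
  rewrite notin_setE => /existsNP[i] /not_implyP[/= iS nA].
  by rewrite (bigD1 i)//= memNset// mul0r.
have cupE : \1_(\bigcup_i A i) x =
    (1 - \prod_i (1 - (x \in A i)%:R) : int)%:~R :> R.
  rewrite indicE; case: (boolP (x \in _)) => [|].
    rewrite inE => -[i _ Ai].
    by rewrite (bigD1 i)//= mem_set// subrr mul0r subr0.
  rewrite notin_setE => h; rewrite big1 ?subrr// => i _.
  by rewrite memNset ?subr0// => Ai; apply: h; exists i.
rewrite cupE.
under [in LHS]eq_bigr do rewrite addrC.
rewrite bigA_distr (bigD1 finset.set0)//=.
(* The empty subset contributes 1, which cancels the leading 1. *)
rewrite [X in 1 - (X + _)]big1 => [|i _]; last by rewrite finset.in_set0.
rewrite opprD addNKr -sumrN rmorph_sum /=; apply: eq_bigr => S S0.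
have S_gt0 : (0 < #|S|)%N by rewrite card_gt0.
rewrite capE -big_mkcond/= prodrN -[X in _ ^+ X](prednK S_gt0) exprS mulN1r mulNr opprK.
by rewrite rmorphM rmorphXn rmorphN1.
Qed.

(** * Representation independence and additivity *)

Lemma bigcap_closed (T : Type) (I : finType) (G : set T -> Prop)
    (S : {set I}) (A : I -> set T) :
  (forall X Y, G X -> G Y -> G (X `&` Y)) -> (forall i, G (A i)) ->
  S != finset.set0 -> G (\bigcap_(i in [set i | i \in S]) A i).
Proof.
move=> GI GA /finset.set0Pn[i0 i0S].
have -> : \bigcap_(i in [set i | i \in S]) A i =
    A i0 `&` \big[setI/setT]_(i <- enum S) A i.
  rewrite -bigcap_seq; apply/seteqP; split => [x h|x [_ h] i /= iS].
    by split; [exact: h|move=> i /=; rewrite mem_enum; exact: h].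
  by apply: h; rewrite /= mem_enum.
elim/big_rec : _ => [|i X _ GX]; first by rewrite setIT.
by rewrite setICA; apply: GI.
Qed.

Section BoxPolyhedra.
Variables (R : realType) (d : nat).
Implicit Types (s : seq R) (A B : set (pt R d)).

(** A box contains its extreme corners, so equal boxes bound each other's corners. Hence the bounds
    chosen inside [Vbox] do not matter. *)
Lemma box_set_inj (lo hi lo' hi' : pt R d) :
  (forall i, lo i <= hi i) -> (forall i, lo' i <= hi' i) ->
  box_set lo hi = box_set lo' hi' -> lo = lo' /\ hi = hi'.
Proof.
move=> lohi lohi' E.
have loB : box_set lo' hi' lo by rewrite -E => i; rewrite lexx lohi.
have hiB : box_set lo' hi' hi by rewrite -E => i; rewrite lexx lohi.
have loB' : box_set lo hi lo' by rewrite E => i; rewrite lexx lohi'.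
have hiB' : box_set lo hi hi' by rewrite E => i; rewrite lexx lohi'.
split; apply/funext => i; apply/eqP; rewrite eq_le.
  by case/andP: (loB i) => -> _; case/andP: (loB' i) => ->.
by case/andP: (hiB i) => _ ->; case/andP: (hiB' i) => _ ->.
Qed.

Lemma Vbox_box k (lo hi : pt R d) : (forall i, lo i <= hi i) ->
  Vbox k (box_set lo hi) = esym_sides k lo hi.
Proof.
move=> lohi; rewrite /Vbox; case: pselect => [h|[]]; last by exists (lo, hi).
case: cid => -[lo' hi'] /= [lohi' E].
by have [-> ->] := box_set_inj lohi lohi' E.
Qed.

Lemma Vbox_set0 k : Vbox k (@set0 (pt R d)) = 0.
Proof.
rewrite /Vbox; case: pselect => // -[[lo hi] /= [lohi E]]; exfalso.
suff : @set0 (pt R d) lo by [].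
by rewrite E => i; rewrite lexx lohi.
Qed.

Definition grid_box s B := B = set0 \/
  exists lo hi : pt R d, [/\ forall i, lo i \in s, forall i, hi i \in s,
    forall i, lo i <= hi i & B = box_set lo hi].

Definition grid_poly s A := exists (I : finType) (F : I -> set (pt R d)),
  (forall i, grid_box s (F i)) /\ A = \bigcup_i F i.

Lemma grid_box_sub s s' B : {subset s <= s'} -> grid_box s B -> grid_box s' B.
Proof.
move=> ss' [->|[lo [hi [los his lohi ->]]]]; [by left|right].
by exists lo, hi; split=> // i; exact: ss'.
Qed.

Lemma grid_box_poly s B : grid_box s B -> grid_poly s B.
Proof. by exists unit, (fun=> B); split=> //; rewrite bigcup_const//; exists tt. Qed.

Lemma grid_box_setI s B B' : grid_box s B -> grid_box s B' ->
  grid_box s (B `&` B').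
Proof.
move=> [->|[lo [hi [los his lohi ->]]]]; first by rewrite set0I; left.
move=> [->|[lo' [hi' [los' his' lohi' ->]]]]; first by rewrite setI0; left.
have -> : box_set lo hi `&` box_set lo' hi' =
    box_set (fun i => Num.max (lo i) (lo' i)) (fun i => Num.min (hi i) (hi' i)).
  apply/seteqP; split=> [x [h h'] i|x h].
    rewrite ge_max le_min; have /andP[-> ->] := h i; by have /andP[-> ->] := h' i.
  by split=> i; have := h i; rewrite ge_max le_min => /andP[/andP[? ?] /andP[? ?]];
     apply/andP.
have [h|/existsNP[i /negP]] :=
    pselect (forall i, Num.max (lo i) (lo' i) <= Num.min (hi i) (hi' i)).
  right; do 2 eexists; split; [| |exact: h|by []] => i.
    by rewrite /Num.max; case: ifP.
  by rewrite /Num.min; case: ifP.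
rewrite -ltNge => h; left; apply/seteqP; split => // x /(_ i) /andP[h1 h2].
by have := lt_le_trans h (le_trans h1 h2); rewrite ltxx.
Qed.

Lemma grid_poly_setI s A A' : grid_poly s A -> grid_poly s A' ->
  grid_poly s (A `&` A').
Proof.
move=> [I [F [Fs ->]]] [I' [F' [Fs' ->]]].
exists (I * I')%type, (fun ij => F ij.1 `&` F' ij.2); split.
  by move=> ij; exact: grid_box_setI.
apply/seteqP; split=> [x [[i _ Fi] [j _ Fj]]|x [[i j] _ [Fi Fj]]].
  by exists (i, j).
by split; [exists i|exists j].
Qed.

Lemma Vbox_Lk s k B : sorted <%R s -> grid_box s B ->
  Vbox k B = Lk s k \1_B.
Proof.
move=> ss [->|[lo [hi [los his lohi ->]]]]; first by rewrite Vbox_set0 Lk0.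
by rewrite Vbox_box// Lk_box.
Qed.

(** Inclusion-exclusion for indicators passes through the linear functional [Lk]. The right-hand
    side sees only the union, which is the source of representation independence. *)
Lemma Vk_fam_Lk s k (Q : box_family R d) : sorted <%R s ->
  (forall i, grid_box s (projT2 Q i)) ->
  Vk_fam k Q = Lk s k \1_(\bigcup_i projT2 Q i).
Proof.
move=> ss Qs; rewrite (Lk_sum _ _ (indic_inclusion_exclusion _ (projT2 Q))).
apply: eq_bigr => S S0; congr *%R; apply: Vbox_Lk => //.
by apply: bigcap_closed => //; exact: grid_box_setI.
Qed.

(** Representations consist of nonempty boxes indexed by ordinals, so the empty members are dropped
    and the remaining ones enumerated. *)
Lemma grid_poly_represents s A : grid_poly s A ->
  exists2 Q, represents A Q & forall i, grid_box s (projT2 Q i).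
Proof.
move=> [I [F [Fs ->]]].
pose J := {i : I | `[< F i !=set0 >]}.
exists (existT (fun m => 'I_m -> set (pt R d)) #|{: J}|
  (fun j => F (val (enum_val j)))); last by move=> i; exact: Fs.
split => [/= j|/=].
  have [F0|] := Fs (val (enum_val j)); last first.
    by move=> [lo [hi [los his lohi ->]]]; exists (lo, hi).
  by have /asboolP := valP (enum_val j); rewrite F0 => -[].
apply/seteqP; split=> x [i _ Fi]; last by exists (val (enum_val i)).
have Fi0 : `[< F i !=set0 >] by apply/asboolP; exists x.
by exists (enum_rank (Sub i Fi0 : J)) => //=; rewrite enum_rankK.
Qed.

(** Take all endpoints of all the boxes together with [s]. Keeping [s] makes a common refinement for
    two representations possible. *)
Lemma represents_grid s A Q : represents A Q -> exists s',
  [/\ sorted <%R s', {subset s <= s'} & forall i, grid_box s' (projT2 Q i)].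
Proof.
move=> [Qbox _]; have [lh lhQ] := choice Qbox.
pose e := [seq (lh ij.1).1 ij.2 | ij : 'I_(projT1 Q) * 'I_d] ++
          [seq (lh ij.1).2 ij.2 | ij : 'I_(projT1 Q) * 'I_d].
pose s' := sort <=%R (undup (s ++ e)).
have mem_s' x : (x \in s') = (x \in s) || (x \in e).
  by rewrite mem_sort mem_undup mem_cat.
exists s'; split.
- by rewrite sort_lt_sorted undup_uniq.
- by move=> x xs; rewrite mem_s' xs.
- move=> i; right; exists (lh i).1, (lh i).2; have [lohi E] := lhQ i.
  split=> // j; rewrite mem_s' mem_cat; apply/orP; right; apply/orP.
    by left; apply/fintype.imageP; exists (i, j).
  by right; apply/fintype.imageP; exists (i, j).
Qed.

(** On a grid fine enough for both families, each side equals [Lk] of the indicator of [A]. *)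
Lemma Vk_fam_eq k A Q Q' : represents A Q -> represents A Q' ->
  Vk_fam k Q = Vk_fam k Q'.
Proof.
move=> AQ AQ'; have [s [ss _ Qs]] := represents_grid [::] AQ.
have [s' [ss' sub Qs']] := represents_grid s AQ'.
rewrite (Vk_fam_Lk _ ss' Qs') (@Vk_fam_Lk s')//; first by rewrite -AQ.2 -AQ'.2.
by move=> i; exact: grid_box_sub (Qs i).
Qed.

Lemma Vk_represents k A Q : represents A Q -> Vk k A = Vk_fam k Q.
Proof.
move=> AQ; rewrite /Vk; case: pselect => [h|[]]; last by exists Q.
by case: cid => Q' /= AQ'; exact: Vk_fam_eq AQ.
Qed.

Lemma Vk_Lk s k A : sorted <%R s -> grid_poly s A -> Vk k A = Lk s k \1_A.
Proof.
move=> ss /grid_poly_represents[Q AQ Qs].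
by rewrite (Vk_represents _ AQ) (Vk_fam_Lk _ ss Qs) -AQ.2.
Qed.

Lemma Vk_inclusion_exclusion s k (I : finType) (A : I -> set (pt R d)) :
  sorted <%R s -> (forall i, grid_poly s (A i)) ->
  Vk k (\bigcup_i A i) = \sum_(S : {set I} | S != finset.set0)
    (-1) ^+ (#|S|.-1) * Vk k (\bigcap_(i in [set i | i \in S]) A i).
Proof.
move=> ss As; rewrite (Vk_Lk _ ss); last first.
  (* The union is again a grid polyhedron: choose a family of boxes for each [A i] and index them
     all by a dependent sum. *)
  pose I' i := projT1 (cid (As i)).
  have IF i : exists F : I' i -> _, _ := projT2 (cid (As i)).
  pose F i := projT1 (cid (IF i)); have AF i := projT2 (cid (IF i)).
  exists {i : I & I' i}, (fun u => F (tag u) (tagged u)); split.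
    by move=> u; exact: (AF _).1.
  apply/seteqP; split=> [x [i _]|x [[i j] _ Fij]].
    by rewrite (AF i).2 => -[j _ Fij]; exists (Tagged I' j).
  by exists i => //; rewrite (AF i).2; exists j.
rewrite (Lk_sum _ _ (indic_inclusion_exclusion _ A)).
apply: eq_bigr => S S0; congr *%R; rewrite (Vk_Lk _ ss)//.
by apply: bigcap_closed => //; exact: grid_poly_setI.
Qed.

Lemma Vk_set0 k : Vk k (@set0 (pt R d)) = 0.
Proof.
by rewrite (@Vk_Lk [::])// ?Lk0//; apply: grid_box_poly; left.
Qed.

End BoxPolyhedra.

(** * Similarities and sets in hyperplanes *)

Section Similarity.
Variables (R : realType) (d : nat) (m : R) (t : pt R d).
Hypothesis m_gt0 : 0 < m.
Implicit Types (lo hi : pt R d).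

(** This expansion is used through preimages: the preimage of a set is its copy scaled by [1/m] and
    shifted by [t/m]. *)
Definition rescale (x : pt R d) : pt R d := fun i => x i * m - t i.

Lemma rescale_box lo hi : rescale @^-1` (box_set lo hi) =
  box_set (fun i => (lo i + t i) / m) (fun i => (hi i + t i) / m).
Proof.
by apply/seteqP; split=> x h i; have := h i;
  rewrite /rescale ler_pdivrMr// ler_pdivlMr// lerBrDr lerBlDr.
Qed.

Lemma le_rescale lo hi : (forall i, lo i <= hi i) ->
  forall i, (lo i + t i) / m <= (hi i + t i) / m.
Proof. by move=> h i; rewrite ler_pM2r ?invr_gt0// lerD2r. Qed.

Lemma Vbox_rescale s k (B : set (pt R d)) : grid_box s B ->
  Vbox k (rescale @^-1` B) = m^-1 ^+ k * Vbox k B.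
Proof.
move=> [->|[lo [hi [_ _ lohi ->]]]].
  by rewrite preimage_set0 !Vbox_set0 mulr0.
rewrite rescale_box !Vbox_box//; last exact: le_rescale.
rewrite /esym_sides mulr_sumr; apply: eq_bigr => S /eqP <-.
rewrite -prodr_const -big_split; apply: eq_bigr => i _ /=.
by rewrite -mulrBl mulrC; congr (_ * _); ring.
Qed.

(** Preimages commute with unions and intersections, so a representation is transported term by term
    and each box scales by [m^-k]. *)
Lemma Vk_rescale s k (A : set (pt R d)) : grid_poly s A ->
  Vk k (rescale @^-1` A) = m^-1 ^+ k * Vk k A.
Proof.
move=> /grid_poly_represents[Q AQ Qs].
pose Q' : box_family R d :=
  existT (fun n => 'I_n -> set (pt R d)) (projT1 Q) (fun i => rescale @^-1` projT2 Q i).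
have AQ' : represents (rescale @^-1` A) Q'.
  split=> [i|]; last by rewrite AQ.2 preimage_bigcup.
  have [[lo hi] /= [lohi E]] := AQ.1 i.
  rewrite E rescale_box; eexists (_, _) => /=; split; last by [].
  exact: le_rescale.
rewrite (Vk_represents _ AQ) (Vk_represents _ AQ') /Vk_fam mulr_sumr.
apply: eq_bigr => S S0; rewrite /= -preimage_bigcap (@Vbox_rescale s) 1?mulrCA//.
by apply: bigcap_closed => //; exact: grid_box_setI.
Qed.

End Similarity.

Section HyperplaneBound.
Variables (R : realType) (d : nat).
Implicit Types (s : seq R).

Lemma cells_bound x s h c : 0 <= h -> path (fun y z => `|z - y| <= h) x s ->
  c \in cells (x :: s) -> `|c.2.1| <= 1 /\ `|c.2.2| <= h.
Proof.
move=> h0; elim: s x => [|y s IH] x.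
  by move=> _; rewrite /= inE => /eqP -> /=; rewrite normr1 normr0.
move=> /andP[xy ys]; rewrite [cells _]/= 2!inE => /or3P[/eqP->|/eqP->|].
- by rewrite /= normr1 normr0.
- by rewrite /= normrN normr1.
- exact: IH.
Qed.

Lemma size_cells s : size (cells s) = (size s).*2.-1.
Proof.
elim: s => [//|x [//|y s] IH]; rewrite [cells _]/=.
by rewrite -[size _]/((size (cells (y :: s))).+2) IH.
Qed.

Lemma cell_in s (i : 'I_(size (cells s))) : cell s i \in cells s.
Proof. exact: mem_nth. Qed.

Lemma sum_cell_at s (v : R) : sorted <%R s ->
  \sum_(i < size (cells s)) ((cell s i).1 == v)%:R <= 1 :> R.
Proof.
move=> ss; rewrite (sum_cell _ (fun c => (c.1 == v)%:R)).
rewrite -natr_sum -[1]/(1%:R) ler_nat.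
have -> : (\sum_(c <- cells s) (c.1 == v) = count_mem v (unzip1 (cells s)))%N.
  by rewrite -sum1_count big_map [RHS]big_mkcond; apply: eq_bigr => c _ /=; case: eqP.
by rewrite count_uniq_mem ?leq_b1// (sorted_uniq lt_trans ltxx)// sorted_cells.
Qed.

(** Along [i0] only the cell sampled at [v], if any, can meet [A]. Each other coordinate offers at
    most all cells, and each of the [k] length factors is at most [h]. *)
Lemma Lk_hyperplane s k h (A : set (pt R d)) (i0 : 'I_d) (v : R) :
  sorted <%R s -> 0 <= h ->
  (forall c, c \in cells s -> `|c.2.1| <= 1 /\ `|c.2.2| <= h) ->
  A `<=` [set x | x i0 = v] ->
  `|Lk s k \1_A| <= #|{: {set 'I_d}}|%:R * (h ^+ k * (size (cells s))%:R ^+ d.-1).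
Proof.
move=> ss h0 sh Av.
have sliceS (S : {set 'I_d}) : #|S| == k ->
    `|\sum_(c : grid_index d s) grid_weight S c * \1_A (grid_pt c)| <=
    h ^+ k * (size (cells s))%:R ^+ d.-1.
  move=> /eqP <-; apply: le_trans (ler_norm_sum _ _ _) _.
  (* The constraint on coordinate [i0] enters as a 0-1 factor, so the sum over grid cells still
     factors over coordinates. *)
  pose w (i : 'I_d) (t : 'I_(size (cells s))) : R :=
    `|if i \in S then (cell s t).2.2 else (cell s t).2.1| *
    (if i == i0 then ((cell s t).1 == v)%:R else 1).
  apply: (@le_trans _ _ (\sum_(c : grid_index d s) \prod_i w i (c i))).
    apply: ler_sum => c _; rewrite big_split /= normrM normr_prod.
    apply: ler_wpM2l; first exact: prodr_ge0.
    rewrite (bigD1 i0)//= eqxx big1 ?mulr1; last by move=> i /negbTE ->.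
    rewrite indicE normr_nat ler_nat.
    case: (boolP (_ \in A)) => // /set_mem /Av /= cv.
    by rewrite lt0b; apply/eqP.
  rewrite -bigA_distr_bigA.
  apply: (@le_trans _ _ (\prod_i ((if i \in S then h else 1) *
      (if i == i0 then 1 else (size (cells s))%:R)))).
    apply: ler_prod => i _; rewrite sumr_ge0/=; last first.
      by move=> t _; rewrite mulr_ge0//; case: ifP.
    apply: (@le_trans _ _ (\sum_(t < size (cells s)) (if i \in S then h else 1) *
      (if i == i0 then ((cell s t).1 == v)%:R else 1))).
      apply: ler_sum => t _; apply: ler_wpM2r; first by case: ifP.
      by have [? ?] := sh _ (cell_in t); case: ifP.
    rewrite -mulr_sumr; apply: ler_wpM2l; first by case: ifP.
    case: ifP => _; first exact: sum_cell_at.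
    by rewrite sumr_const card_ord.
  rewrite big_split /= -big_mkcond /= prodr_const ler_wpM2l ?exprn_ge0//.
  rewrite (bigD1 i0)//= eqxx mul1r.
  rewrite (eq_bigr (fun=> (size (cells s))%:R)); last by move=> i /negbTE ->.
  by rewrite prodr_const cardC1 card_ord.
apply: le_trans (ler_norm_sum _ _ _) _.
apply: le_trans (ler_sum _ sliceS) _.
rewrite [leLHS]big_mkcond.
apply: le_trans (_ : \sum_(S : {set 'I_d}) (h ^+ k * (size (cells s))%:R ^+ d.-1) <= _).
  by apply: ler_sum => S _; case: ifP => // _; rewrite mulr_ge0 ?exprn_ge0.
by rewrite sumr_const mulr_natl.
Qed.

Definition unit_grid (N : nat) : seq R := [seq i%:R / N%:R | i <- iota 0 N.+1].

Lemma unit_gridP N i : (i <= N)%N -> i%:R / N%:R \in unit_grid N.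
Proof. by move=> iN; apply/mapP; exists i => //; rewrite mem_iota. Qed.

Lemma sorted_unit_grid N : (0 < N)%N -> sorted <%R (unit_grid N).
Proof.
move=> N0; rewrite sorted_map.
rewrite (eq_sorted (e' := ltn)) ?iota_ltn_sorted// => i j /=.
by rewrite ltr_pM2r ?ltr_nat// invr_gt0 ltr0n.
Qed.

Lemma path_unit_grid N a n :
  path (fun y z => `|z - y| <= N%:R^-1) (a%:R / N%:R : R)
    [seq i%:R / N%:R | i <- iota a.+1 n].
Proof.
elim: n a => [//|n IH] a /=; rewrite IH andbT -mulrBl -natr1 addrC addKr mul1r.
by rewrite ger0_norm ?invr_ge0.
Qed.

Lemma Vk_hyperplane N k (A : set (pt R d)) (i0 : 'I_d) (v : R) :
  (0 < N)%N -> grid_poly (unit_grid N) A -> A `<=` [set x | x i0 = v] ->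
  `|Vk k A| <= #|{: {set 'I_d}}|%:R * (N%:R^-1 ^+ k * (4 * N%:R) ^+ d.-1).
Proof.
move=> N0 AN Av; rewrite (Vk_Lk _ (sorted_unit_grid N0) AN).
have hN : 0 <= N%:R^-1 :> R by rewrite invr_ge0.
have cN c : c \in cells (unit_grid N) -> `|c.2.1| <= 1 /\ `|c.2.2| <= N%:R^-1.
  by apply: cells_bound => //; exact: (path_unit_grid N 0 N).
apply: le_trans (Lk_hyperplane _ (sorted_unit_grid N0) hN cN Av) _.
apply: ler_wpM2l => //; apply: ler_wpM2l; first exact: exprn_ge0.
apply: lerXn2r; rewrite ?nnegrE ?mulr_ge0//.
(* The grid has [N+1] points, hence [2N+1 <= 4N] cells. *)
rewrite -natrM ler_nat size_cells size_map size_iota.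
by rewrite -mul2n; case: N N0 {AN hN cN} => // N _; lia.
Qed.

End HyperplaneBound.

(** * Product Bernoulli measures *)

Section Bernoulli.
Variables (R : realType) (p : R).

Definition coin (b : bool) : R := if b then p else 1 - p.

Lemma sum_coin : \sum_b coin b = 1.
Proof. by rewrite big_bool /coin /=; ring. Qed.

Variables (I I' : finType) (g : I' -> I) (t0 : I).
Hypotheses (g_inj : injective g) (g_t0 : forall s, g s != t0).

(** Independence of the coin [t0] and the coins in the image of [g]: prescribing them restricts each
    coin separately, so the sum of products factors. *)
Lemma sum_coins_fiber (b0 : bool) (v : {ffun I' -> bool}) :
  \sum_(w : {ffun I -> bool} | (w t0, [ffun s => w (g s)]) == (b0, v))
     \prod_t coin (w t) = coin b0 * \prod_s coin (v s).
Proof.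
(* [Q t] is the set of admissible values of coin [t]: forced at [t0] and on the image of [g], free
   elsewhere. *)
pose Q t : pred bool :=
  [pred b | ((t == t0) ==> (b == b0)) && [forall s, (g s == t) ==> (b == v s)]].
rewrite (eq_bigl (fun w => w \in family Q)); last first.
  move=> w; apply/eqP/familyP => [[wb wv] t|wQ].
    rewrite inE; apply/andP; split; first by apply/implyP => /eqP ->; rewrite wb.
    by apply/forallP => s; apply/implyP => /eqP <-; rewrite -wv ffunE.
  have /= /andP[/implyP/(_ (eqxx _))/eqP -> _] := wQ t0.
  congr (_, _); apply/ffunP => s; rewrite ffunE.
  by have /= /andP[_ /forallP/(_ s)/implyP/(_ (eqxx _))/eqP] := wQ (g s).
rewrite -(bigA_distr_big_dep Q (fun=> coin)) (bigD1 t0)//=; congr *%R.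
  rewrite (big_pred1 b0)// => b; rewrite /Q /= eqxx.
  by rewrite andb_idr// => _; apply/forallP => s; rewrite (negbTE (g_t0 s)).
rewrite (bigID (fun t => t \in [set g s | s in I'])%SET)/=.
(* Each free coin sums to 1. *)
rewrite [X in _ * X]big1 ?mulr1 => [|t /andP[/negbTE tt0 tg]]; last first.
  rewrite -[RHS]sum_coin; apply: eq_bigl => b; rewrite /Q /= tt0/=.
  apply/forallP => s; apply/implyP => /eqP gst.
  by case/imsetP: tg; exists s.
rewrite (eq_bigl (fun t => t \in [set g s | s in I'])%SET); last first.
  by move=> t; rewrite andb_idl// => /imsetP[s _ ->].
rewrite big_imset/=; last by move=> s s' _ _; exact: g_inj.
apply: eq_bigr => s _; rewrite (big_pred1 (v s))// => b; rewrite /Q /=.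
rewrite (negbTE (g_t0 s))/=; apply/forallP/eqP => [/(_ s)|->].
  by rewrite eqxx => /eqP.
by move=> s'; apply/implyP => /eqP/g_inj ->.
Qed.

(** Group the outcomes by the values of the coins that [f] sees. *)
Lemma sum_coins_restrict (f : bool -> {ffun I' -> bool} -> R) :
  \sum_(w : {ffun I -> bool})
     (\prod_t coin (w t)) * f (w t0) [ffun s => w (g s)] =
  \sum_b coin b * \sum_(v : {ffun I' -> bool}) (\prod_s coin (v s)) * f b v.
Proof.
under [RHS]eq_bigr do rewrite mulr_sumr.
rewrite pair_bigA.
rewrite (partition_big
  (fun w : {ffun I -> bool} => (w t0, [ffun s => w (g s)])) predT)//=.
apply: eq_bigr => -[b v] _ /=; rewrite mulrA -sum_coins_fiber mulr_suml.
by apply: eq_bigr => w /eqP[<- <-].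
Qed.

Lemma sum_coins1 : \sum_(v : {ffun I' -> bool}) \prod_s coin (v s) = 1.
Proof.
by rewrite -(bigA_distr_bigA (fun _ : I' => coin)) big1// => s _; exact: sum_coin.
Qed.

End Bernoulli.

(** * Self-similarity of the percolation *)

Section Percolation.
Variables (R : realType) (d M : nat).
Hypothesis M_gt0 : (0 < M)%N.

Local Notation cubeR := (@cube_set R d M _).
Local Notation CnR := (@Cn R d M _).
Local Notation CnjR := (@Cnj R d M _).

Let Mn_gt0 n : (0 < M ^ n)%N. Proof. by rewrite expn_gt0 M_gt0. Qed.

Lemma cat_cube_subproof n (a : 'I_(M ^ 1)) (b : 'I_(M ^ n)) :
  (a * M ^ n + b < M ^ n.+1)%N.
Proof.
have aM : (a < M)%N by case: a => a; rewrite expn1.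
apply: (@leq_trans (a.+1 * M ^ n)); first by rewrite mulSn addnC ltn_add2r.
by rewrite [leqRHS]expnS leq_mul2r aM orbT.
Qed.

(* The level-[n.+1] cube sitting in the first-level cube [j] the way the
   level-[n] cube [y] sits in the unit cube. *)
Definition cat_cube n (j : cube d M 1) (y : cube d M n) : cube d M n.+1 :=
  [ffun i => Ordinal (cat_cube_subproof (j i) (y i))].

Lemma cat_cube_inj n j : injective (@cat_cube n j).
Proof.
move=> y y' /ffunP e; apply/ffunP => i; apply: val_inj.
by have := congr1 val (e i); rewrite !ffunE /= => /addnI.
Qed.

Lemma cat_cubeP n (j : cube d M 1) (x : cube d M n.+1) :
  (forall i, (x i %/ M ^ n)%N = j i) -> exists y, x = cat_cube j y.
Proof.
move=> xj; exists [ffun i => Ordinal (ltn_pmod (x i) (Mn_gt0 n))].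
by apply/ffunP => i; apply: val_inj; rewrite !ffunE /= -xj -divn_eq.
Qed.

Lemma cat_cube_div n j (y : cube d M n) i : (cat_cube j y i %/ M ^ n)%N = j i.
Proof. by rewrite ffunE /= divnMDl// divn_small ?addn0. Qed.

(** Tag [m] carries the coins of level [m+1], so tag 0 is the coin of the first-level cube [j]
    itself. *)
Definition root_coin n (j : cube d M 1) : {m : 'I_n.+1 & cube d M m.+1} :=
  existT (fun m : 'I_n.+1 => cube d M m.+1) ord0 j.

Definition sub_coin n (j : cube d M 1) (t : {m : 'I_n & cube d M m.+1}) :
    {m : 'I_n.+1 & cube d M m.+1} :=
  existT (fun m : 'I_n.+1 => cube d M m.+1)
    (@Ordinal n.+1 (tag t).+1 (ltn_ord (tag t))) (cat_cube j (tagged t)).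

Lemma sub_coin_inj n j : injective (@sub_coin n j).
Proof.
move=> [m y] [m' y'] e.
have /val_inj mm' : val m = val m'.
  by have /= := congr1 (fun t => val (tag t)) e; case.
move: mm' y' e => <- y' /eqP; rewrite /sub_coin /= => /eqP e.
have /eqP := e; rewrite (eq_Tagged (T_ := fun m : 'I_n.+1 => cube d M m.+1)) /=.
by move=> /eqP /cat_cube_inj ->.
Qed.

Lemma sub_coin_root n j t : @sub_coin n j t != root_coin n j.
Proof. by apply/eqP => /(congr1 (fun t => val (tag t))). Qed.

Definition sub_coins n (j : cube d M 1) (w : coins d M n.+1) : coins d M n :=
  [ffun t => w (sub_coin j t)].

Lemma is_anc_root n j (y : cube d M n) : is_anc (root_coin n j) (cat_cube j y).
Proof. by apply/forallP => i /=; rewrite subn1 /= cat_cube_div. Qed.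

Lemma div_cat n m a b : (m < n)%N ->
  ((a * M ^ n + b) %/ M ^ (n.+1 - m.+2) = a * M ^ m.+1 + b %/ M ^ (n - m.+1))%N.
Proof.
move=> mn; rewrite subSS -{1}(subnK mn) expnD mulnCA mulnC.
by rewrite divnMDl.
Qed.

Lemma is_anc_sub n j (y : cube d M n) t :
  is_anc t y -> is_anc (sub_coin j t) (cat_cube j y).
Proof.
move=> /forallP h; apply/forallP => i /=.
by rewrite !ffunE /= div_cat// -(eqP (h i)).
Qed.

(** An ancestor at tag 0 must be [j]. At tag [m+1], removing the leading base-[M] digit [j] leaves
    an ancestor of [y] at tag [m]. *)
Lemma is_anc_cat n j (y : cube d M n) t : is_anc t (cat_cube j y) ->
  t = root_coin n j \/ exists2 t', is_anc t' y & t = sub_coin j t'.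
Proof.
case: t => -[[|m] mn] z /forallP /= h; [left|right].
  (* The bound proof inside the ordinal is replaced by the canonical one, so that the dependent
     pairs have the same tag. *)
  move: z h; rewrite (bool_irrelevance mn (ltn0Sn n)) => z h.
  congr (existT _ _ _); apply/ffunP => i; apply: val_inj.
  by rewrite [LHS](eqP (h i)) subn1 /= cat_cube_div.
have mn' : (m < n)%N by [].
have ylt i : (y i %/ M ^ (n - m.+1) < M ^ m.+1)%N.
  by rewrite ltn_divLR// -expnD subnKC.
exists (existT (fun m : 'I_n => cube d M m.+1) (Ordinal mn')
   [ffun i => Ordinal (ylt i)]).
  by apply/forallP => i; rewrite /= ffunE.
rewrite /sub_coin /=; move: z h.
rewrite (bool_irrelevance mn (ltn_ord (Ordinal mn'))) => z h.
congr (existT _ _ _); apply/ffunP => i; apply: val_inj.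
by rewrite [LHS](eqP (h i)) !ffunE /= div_cat// ffunE.
Qed.

Lemma kept_cat n j (w : coins d M n.+1) (y : cube d M n) :
  kept w (cat_cube j y) = w (root_coin n j) && kept (sub_coins j w) y.
Proof.
apply/forallP/andP => [h|[wj /forallP h] t].
  split; first by have /implyP := h (root_coin n j); apply; exact: is_anc_root.
  apply/forallP => t; apply/implyP => ty; rewrite ffunE.
  by have /implyP := h (sub_coin j t); apply; exact: is_anc_sub.
apply/implyP => /is_anc_cat[->//|[t' ty ->]].
by have := h t'; rewrite ty ffunE.
Qed.

Lemma cube_set_cat n (j : cube d M 1) (y : cube d M n) :
  cubeR (cat_cube j y) =
  rescale M%:R (fun i => (j i)%:R) @^-1` (cubeR y).
Proof.
have MS : (M ^ n.+1)%:R = (M ^ n)%:R * M%:R :> R by rewrite expnSr natrM.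
have Mn0 : (M ^ n)%:R != 0 :> R by rewrite pnatr_eq0 -lt0n.
have M0 : M%:R != 0 :> R by rewrite pnatr_eq0 -lt0n.
have catE (a b : nat) : (a * M ^ n + b)%:R / (M ^ n.+1)%:R =
    (b%:R / (M ^ n)%:R + a%:R) / M%:R :> R.
  by rewrite MS natrD natrM invfM mulrA mulrDl mulfK// addrC.
rewrite /cube_set rescale_box ?ltr0n//; congr box_set; apply/funext => i.
  by rewrite ffunE /= catE.
by rewrite ffunE /= -addnS catE.
Qed.

Definition unit_cube : set (pt R d) := box_set (fun=> 0) (fun=> 1).

Lemma bigcup_cube_set n :
  \bigcup_(x in [set: cube d M n]) cubeR x = unit_cube.
Proof.
apply/seteqP; split=> [x [y _ xy] i|x x01].
  have /andP[lo hi] := xy i; rewrite (le_trans _ lo) ?divr_ge0//= (le_trans hi)//.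
  by rewrite ler_pdivrMr ?ltr0n// mul1r ler_nat.
(* The integer part is capped at [M^n - 1] so that a coordinate equal to 1 falls into the last
   cube. *)
have ylt i : (minn (Num.truncn (x i * (M ^ n)%:R)) (M ^ n).-1 < M ^ n)%N.
  by rewrite gtn_min orbC prednK ?leqnn.
exists [ffun i => Ordinal (ylt i)] => // i; rewrite ffunE /=.
have /andP[x0 x1] := x01 i.
rewrite ler_pdivrMr ?ltr0n// ler_pdivlMr ?ltr0n//.
have xM0 : 0 <= x i * (M ^ n)%:R by rewrite mulr_ge0.
have /andP[tl tu] := Num.Theory.truncn_itv xM0.
move: (Num.truncn _) tl tu => u tl tu {ylt}.
have [le_u|lt_u] := leqP u (M ^ n).-1.
  by rewrite tl ltW.
apply/andP; split.
  by apply: le_trans tl; rewrite ler_nat ltnW.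
by rewrite prednK// ler_piMl.
Qed.

(** If the coin of [j] fails, all its subcubes are removed and tile it. Otherwise the removed
    subcubes are those of the percolation driven by the coins below [j]. *)
Lemma Cnj_cat n (w : coins d M n.+1) j :
  CnjR w j = rescale M%:R (fun i => (j i)%:R) @^-1`
    (if w (root_coin n j) then CnR (sub_coins j w) else unit_cube).
Proof.
have -> : CnjR w j = \bigcup_(y in [set y | ~~ kept w (cat_cube j y)])
    cubeR (cat_cube j y).
  apply/seteqP; split=> [z [x [kx /cat_cubeP[y xy]] xz]|z [y ky yz]].
    by exists y; rewrite /= -?xy.
  by exists (cat_cube j y) => //; split=> // i; exact: cat_cube_div.
under eq_bigcupr do rewrite cube_set_cat.
rewrite -preimage_bigcup; congr (_ @^-1` _).
case: ifP => wj.
  by apply: eq_bigcupl; split=> y /=; rewrite kept_cat wj.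
rewrite -(bigcup_cube_set n); apply: eq_bigcupl; split=> y //= _.
by rewrite kept_cat wj.
Qed.

Lemma Cn_bigcup n (w : coins d M n.+1) : CnR w = \bigcup_j CnjR w j.
Proof.
apply/seteqP; split=> [z [x kx xz]|z [j _ [x [kx _] xz]]]; last by exists x.
have xM i : (x i %/ M ^ n < M ^ 1)%N by rewrite ltn_divLR// -expnD.
exists [ffun i => Ordinal (xM i)] => //; exists x => //; split => // i.
by rewrite ffunE.
Qed.

Lemma grid_box_cube n (x : cube d M n) : grid_box (unit_grid R (M ^ n)) (cubeR x).
Proof.
right; do 2 eexists; split; last by []; move=> i.
- by apply: unit_gridP; rewrite ltnW.
- exact: unit_gridP.
- by rewrite ler_pM2r ?invr_gt0 ?ltr0n// ler_nat.
Qed.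

Lemma grid_poly_cubes n (P : set (cube d M n)) :
  grid_poly (unit_grid R (M ^ n)) (\bigcup_(x in P) cubeR x).
Proof.
exists {x : cube d M n | `[< P x >]}, (fun x => cubeR (val x)); split.
  by move=> x; exact: grid_box_cube.
apply/seteqP; split=> [z [x Px xz]|z [[x Px] _ xz]].
  by exists (Sub x (asboolT Px)).
by exists x => //; apply/asboolP.
Qed.

Lemma grid_poly_Cnj n (w : coins d M n) j :
  grid_poly (unit_grid R (M ^ n)) (CnjR w j).
Proof. exact: grid_poly_cubes. Qed.

(** Condition on the coin of [j]: the coins below it are independent of it and distributed as those
    of an [n]-level percolation. *)
Lemma Expect_Cnj n (p : R) k j :
  Expect p (fun w : coins d M n.+1 => Vk k (CnjR w j)) =
  M%:R^-1 ^+ k * (p * Expect p (fun v : coins d M n => Vk k (CnR v)) +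
                  (1 - p) * Vk k unit_cube).
Proof.
have M0 : 0 < M%:R :> R by rewrite ltr0n.
pose f (b : bool) (v : coins d M n) : R :=
  M%:R^-1 ^+ k * Vk k (if b then CnR v else unit_cube).
transitivity (\sum_(w : coins d M n.+1)
    (\prod_t coin p (w t)) * f (w (root_coin n j)) (sub_coins j w)).
  apply: eq_bigr => w _; congr *%R.
  rewrite Cnj_cat (Vk_rescale _ M0 (s := unit_grid R (M ^ n)))//.
  by case: ifP => _; rewrite -?(bigcup_cube_set n); exact: grid_poly_cubes.
rewrite (sum_coins_restrict p (@sub_coin_inj n j) (@sub_coin_root n j) f).
rewrite big_bool /= mulrDr; congr +%R.
  rewrite mulrCA; congr *%R; rewrite mulr_sumr.
  by apply: eq_bigr => v _; rewrite /f mulrCA.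
rewrite /f /= -mulr_suml sum_coins1 mul1r; exact: mulrCA.
Qed.

Lemma Cnj_sub n (w : coins d M n) j x i : (0 < n)%N -> CnjR w j x ->
  (j i)%:R / M%:R <= x i <= (j i).+1%:R / M%:R.
Proof.
case: n w => // n w _; rewrite Cnj_cat; set A := (X in _ @^-1` X).
have AI : A `<=` unit_cube.
  rewrite /A; case: ifP => _ //; rewrite -(bigcup_cube_set n).
  by apply: bigcup_subset.
move=> /AI /(_ i); rewrite /rescale subr_ge0 lerBlDr.
by rewrite ler_pdivrMr ?ler_pdivlMr ?ltr0n// nat1r.
Qed.

(** Two distinct first-level cubes differ in some coordinate, where one ends no later than the other
    begins. The hyperplane depends on [T] but not on [w]. *)
Lemma bigcap_Cnj_hyperplane n (T : {set cube d M 1}) : (0 < n)%N ->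
  (1 < #|T|)%N -> exists (i : 'I_d) (v : R), forall w : coins d M n,
  \bigcap_(j in [set j | j \in T]) CnjR w j `<=` [set x | x i = v].
Proof.
move=> n0 /card_gt1P[j [j' [jT j'T jj']]].
wlog [i lt_j] : j j' jT j'T jj' / exists i, (j i < j' i)%N.
  move=> H; have [i ji] : exists i, j i != j' i.
    by apply/existsP; apply: contraR jj' => /existsPn h;
       apply/eqP/ffunP => i; apply/eqP; have := h i; rewrite negbK.
  have [jj|jj|/val_inj /eqP] := ltngtP (j i) (j' i); last by rewrite (negbTE ji).
    by apply: (H j j') => //; exists i.
  by apply: (H j' j) => //; [rewrite eq_sym|exists i].
exists i, ((j' i)%:R / M%:R) => w x h /=.
have /andP[_ h1] := Cnj_sub i n0 (h j jT).
have /andP[h2 _] := Cnj_sub i n0 (h j' j'T).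
apply/eqP; rewrite eq_le h2 (le_trans h1)//.
by rewrite ler_pM2r ?invr_gt0 ?ltr0n// ler_nat.
Qed.

Lemma Vk_bigcap_Cnj n k (T : {set cube d M 1}) (w : coins d M n) : (0 < n)%N ->
  (1 < #|T|)%N ->
  `|Vk k (\bigcap_(j in [set j | j \in T]) CnjR w j)| <=
  #|{: {set 'I_d}}|%:R * ((M ^ n)%:R^-1 ^+ k * (4 * (M ^ n)%:R) ^+ d.-1).
Proof.
move=> n0 T1; have [i [v h]] := bigcap_Cnj_hyperplane n0 T1.
apply: (Vk_hyperplane k (Mn_gt0 n) _ (h w)).
apply: bigcap_closed; first exact: grid_poly_setI.
  by move=> j; exact: grid_poly_Cnj.
by rewrite -card_gt0 ltnW.
Qed.

Lemma norm_Expect n (p C : R) (f : coins d M n -> R) : 0 <= p <= 1 ->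
  (forall w, `|f w| <= C) -> `|Expect p f| <= C.
Proof.
move=> /andP[p0 p1] fC; apply: le_trans (ler_norm_sum _ _ _) _.
have w0 (w : coins d M n) : 0 <= weight p w.
  by apply: prodr_ge0 => t _; case: ifP => // _; rewrite subr_ge0.
apply: (@le_trans _ _ (\sum_(w : coins d M n) weight p w * C)).
  by apply: ler_sum => w _; rewrite normrM ger0_norm// ler_wpM2l.
by rewrite -mulr_suml (sum_coins1 p) mul1r.
Qed.

End Percolation.

(** * Recursion for the expectations *)

Section Assembly.
Variables (R : realType) (d M k : nat) (p : R).
Hypothesis M_gt1 : (1 < M)%N.

Let M_gt0 : (0 < M)%N := ltnW M_gt1.

Lemma Expect_sum n (I : finType) (P : pred I) (c : I -> R)
    (f : I -> coins d M n -> R) :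
  Expect p (fun w => \sum_(i | P i) c i * f i w) =
  \sum_(i | P i) c i * Expect p (f i).
Proof.
rewrite /Expect; under eq_bigr do rewrite mulr_sumr.
rewrite exchange_big; apply: eq_bigr => i _ /=; rewrite mulr_sumr.
by apply: eq_bigr => w _; rewrite mulrCA.
Qed.

Local Notation e n := (Expect p (fun w : coins d M n => Vk k (@Cn R d M n w))).
Local Notation eT T n := (Expect p (fun w : coins d M n =>
  Vk k (\bigcap_(j in [set j | j \in T]) @Cnj R d M n w j))).
Local Notation q := (Vk k (@unit_cube R d)).

(** There are no coins at level 0, so [C_0] is empty; this is the initial value of the recursion. *)
Lemma Expect_Cn0 : e 0%N = 0.
Proof.
rewrite /Expect big1// => w _; suff -> : Cn w = set0 :> set (pt R d).
  by rewrite Vk_set0 mulr0.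
apply/seteqP; split=> // x [y /= ky _]; case/negP: ky.
by apply/forallP => -[[]].
Qed.

Lemma Expect_CnS n : e n.+1 =
  M%:R ^+ d * (M%:R^-1 ^+ k * (p * e n + (1 - p) * q)) +
  \sum_(T : {set cube d M 1} | (2 <= #|T|)%N) (-1) ^+ (#|T|.-1) * eT T n.+1.
Proof.
transitivity (\sum_(T : {set cube d M 1} | T != finset.set0)
    (-1) ^+ (#|T|.-1) * eT T n.+1).
  rewrite -Expect_sum; apply: eq_bigr => w _; congr *%R; rewrite Cn_bigcup//.
  apply: (@Vk_inclusion_exclusion _ _ (unit_grid R (M ^ n.+1))).
    by rewrite sorted_unit_grid// expn_gt0 M_gt0.
  by move=> j; exact: grid_poly_Cnj.
(* Singletons [T] give the self-similar part; the remaining nonempty sets have at least two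
   elements. *)
rewrite (bigID (fun T : {set cube d M 1} => #|T| == 1%N)) /=; congr +%R; last first.
  by apply: eq_bigl => T; rewrite -card_gt0; case: #|T| => [|[]].
rewrite (eq_bigl (fun T => T \in [set [set j] | j in cube d M 1]%SET)); last first.
  move=> T; apply/andP/imsetP => [[_ /cards1P[j ->]]|[j _ ->]]; first by exists j.
  by rewrite -card_gt0 cards1.
rewrite big_imset/=; last by move=> j j' _ _; exact: finset.set1_inj.
(* All [M^d] singletons contribute the same expectation. *)
rewrite (eq_bigr (fun=> M%:R^-1 ^+ k * (p * e n + (1 - p) * q))); last first.
  move=> j _; rewrite cards1 expr0 mul1r -(Expect_Cnj M_gt0 _ _ _ j).
  apply: eq_bigr => w _; congr (_ * Vk k _).
  by rewrite -[RHS]bigcap_set1; apply: eq_bigcapl; split=> i /=;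
     rewrite finset.in_set1 => /eqP.
rewrite sumr_const -[LHS]mulr_natl; congr *%R.
by rewrite card_ffun !card_ord expn1 natrX.
Qed.

End Assembly.

(** * Normalising factors and convergence of the series *)

Section Rates.
Variables (R : realType) (d M k : nat) (p : R).
Hypotheses (M_gt1 : (1 < M)%N) (p_gt0 : 0 < p).

Let M_gt0 : 0 < M%:R :> R. Proof. by rewrite ltr0n ltnW. Qed.

Let Mdp_gt0 : 0 < M%:R ^+ d * p. Proof. by rewrite mulr_gt0// exprn_gt0. Qed.

Let lnM_gt0 : 0 < ln (M%:R : R). Proof. by rewrite ln_gt0// ltr1n. Qed.

(** By definition of the dimension, [M^D = M^d p], hence [r^(D-k) = M^k / (M^d p)]. *)
Lemma powR_rr n : rr R M `^ (n%:R * (Dim d M p - k%:R)) =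
  (M%:R ^+ k / (M%:R ^+ d * p)) ^+ n.
Proof.
rewrite /rr /powR invr_eq0 gt_eqF// lnV ?posrE// -mulrA expRM_natl; congr (_ ^+ _).
rewrite -[RHS]lnK ?posrE ?divr_gt0 ?exprn_gt0//; congr expR.
rewrite ln_div ?posrE ?exprn_gt0// lnXn// /Dim mulrN mulrBl.
by rewrite divfK ?gt_eqF// opprB mulr_natl.
Qed.

Lemma growth_rate_lt1 : k%:R < Dim d M p -> M%:R ^+ k / (M%:R ^+ d * p) < 1.
Proof.
rewrite /Dim ltr_pdivlMr// mulr_natl -lnXn// ltr_ln ?posrE ?exprn_gt0// => h.
by rewrite ltr_pdivrMr// mul1r.
Qed.

(** Absolute convergence by comparison with a geometric series: the normalising factor times
    [M^-k M^(d-1)] is [1/(Mp) < 1]. *)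
Lemma cvg_series_face (u : nat -> R) (C : R) : (0 < d)%N -> M%:R^-1 < p ->
  (forall n, `|u n| <= C * ((M ^ n.+1)%:R^-1 ^+ k * (4 * (M ^ n.+1)%:R) ^+ d.-1)) ->
  cvgn (series (fun n => (M%:R ^+ k / (M%:R ^+ d * p)) ^+ n.+1 * u n) : R^nat).
Proof.
move=> d0 hp hu; apply: normed_cvg.
pose z := (M%:R * p)^-1.
have z_gt0 : 0 < z by rewrite invr_gt0 mulr_gt0.
have z_lt1 : z < 1.
  by rewrite invf_lt1 ?mulr_gt0// mulrC -ltr_pdivrMr// div1r.
have zE : M%:R ^+ k / (M%:R ^+ d * p) * (M%:R^-1 ^+ k * M%:R ^+ d.-1) = z.
  rewrite /z -(prednK d0) exprS /= exprVn; field.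
  by rewrite !expf_eq0 !gt_eqF ?andbF.
(* Nonnegativity of [C] is read off from the bound at [n = 0], whose other factor is positive. *)
have pos : 0 < (M ^ 1)%:R^-1 ^+ k * (4 * (M ^ 1)%:R) ^+ d.-1 :> R.
  by rewrite expn1 mulr_gt0 ?exprn_gt0 ?invr_gt0 ?mulr_gt0.
(* The extra factor [z] accounts for the exponent [n.+1]. *)
apply: (@series_le_cvg _ _ (geometric (C * 4 ^+ d.-1 * z) z)) => [n|n|n|].
- exact: normr_ge0.
- rewrite /= mulr_ge0 ?exprn_ge0 ?(ltW z_gt0)// mulr_ge0 ?(ltW z_gt0)//.
  rewrite mulr_ge0 ?exprn_ge0//.
  by have := le_trans (normr_ge0 _) (hu 0%N); rewrite pmulr_lge0.
- rewrite [leLHS]/= normrM ger0_norm; last first.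
    by rewrite exprn_ge0// divr_ge0 ?exprn_ge0// ltW.
  apply: le_trans (ler_wpM2l _ (hu n)) _.
    by rewrite exprn_ge0// divr_ge0 ?exprn_ge0// ltW.
  rewrite le_eqVlt; apply/orP; left; apply/eqP.
  rewrite [RHS]/= -[RHS]mulrA -exprS -zE !exprMn natrX -!exprVn -!exprM.
  by rewrite [(n.+1 * k)%N]mulnC [(n.+1 * d.-1)%N]mulnC; ring.
- by apply: is_cvg_geometric_series; rewrite ger0_norm ?ltW.
Qed.

End Rates.

(** * Telescoping and passage to the limit *)

Unset Implicit Arguments.

Theorem theorem5p1 (R : realType) (d M : nat) (p : R) (k : nat)
  (hd : (1 <= d)%N) (hM : (2 <= M)%N)
  (hp1 : (M%:R)^-1 < p) (hp2 : p <= 1)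
  (hk : (k <= d)%N) (hkD : k%:R < Dim d M p) :
  let D := Dim d M p in
  let r := rr R M in
  let q := Vk k [set y : pt R d | forall i, 0 <= y i <= 1] in
  let a := fun n : nat =>
    r `^ (n%:R * (D - k%:R)) * Expect p (fun w : coins d M n => Vk k (Cn w)) in
  let b := fun (T : {set cube d M 1}) (n : nat) =>
    r `^ (n%:R * (D - k%:R)) *
      Expect p (fun w : coins d M n =>
        Vk k (\bigcap_(j in [set j | j \in T]) Cnj w j)) in
  (forall T : {set cube d M 1}, (2 <= #|T|)%N ->
     cvgn (fun N => \sum_(1 <= n < N) b T n)) /\
  a @ \oo -->
    q * ((M%:R ^+ (d - k) * (1 - p)) / (M%:R ^+ (d - k) * p - 1)) +
    \sum_(T : {set cube d M 1} | (2 <= #|T|)%N)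
       (-1) ^+ (#|T|.-1) * limn (fun N => \sum_(1 <= n < N) b T n).
Proof.
move=> D r q a b.
have M0 : 0 < M%:R :> R by rewrite ltr0n ltnW.
have p0 : 0 < p by rewrite (lt_trans _ hp1)// invr_gt0.
set th := M%:R ^+ k / (M%:R ^+ d * p).
have powE n : r `^ (n%:R * (D - k%:R)) = th ^+ n by exact: powR_rr.
(* The sums start at 1 and exclude [N], whereas [series] starts at 0; both shifts are absorbed
   here. *)
have bE (T : {set cube d M 1}) N :
    \sum_(1 <= n < N.+1) b T n = series (fun n => b T n.+1) N.
  by rewrite /series /= big_add1.
have bcvg (T : {set cube d M 1}) : (2 <= #|T|)%N ->
    cvgn (fun N => \sum_(1 <= n < N) b T n).
  move=> T2; have : cvgn (series (fun n => b T n.+1) : R^nat).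
    rewrite /b; under eq_fun do rewrite powE.
    apply: (@cvg_series_face _ _ _ _ _ _ _ _ (#|{: {set 'I_d}}|%:R)) => // n.
    apply: norm_Expect; first by rewrite (ltW p0) hp2.
    by move=> w; apply: Vk_bigcap_Cnj => //; rewrite ltnW.
  move=> /cvg_ex[l bl]; apply/cvg_ex; exists l.
  by rewrite -cvg_shiftS /=; under eq_fun do rewrite bE.
split=> //.
have th0 : 0 < th by rewrite divr_gt0 ?mulr_gt0 ?exprn_gt0.
have th1 : th < 1 by exact: growth_rate_lt1.
pose c := q * (M%:R ^+ (d - k) * (1 - p)).
have thE : M%:R ^+ (d - k) * p = th^-1.
  rewrite invf_div -(subnK hk) exprD addnK; field.
  by rewrite expf_eq0 gt_eqF ?andbF.
(* The recursion multiplied by [th^(n+1)]: since [th] inverts [M^(d-k) p], the previous term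
   reappears as [a n], and each step adds [c th^(n+1)] and the normalised overlap terms. *)
have aE n : a n = c * series (geometric th th) n +
    \sum_(T : {set cube d M 1} | (2 <= #|T|)%N)
       (-1) ^+ (#|T|.-1) * \sum_(1 <= m < n.+1) b T m.
  elim: n => [|n IH].
    rewrite /a Expect_Cn0 mulr0 /series /= big_geq// mulr0 add0r.
    by rewrite big1// => T _; rewrite big_geq// mulr0.
  rewrite [in RHS]seriesSr mulrDr /=.
  under eq_bigr do rewrite big_nat_recr//= mulrDr.
  rewrite big_split /= addrACA -IH [in LHS]/a Expect_CnS// mulrDr [RHS]addrA; congr +%R.
    rewrite /a !powE exprS.
    set E := Expect p _.
    have -> : M%:R ^+ d * (M%:R^-1 ^+ k * (p * E + (1 - p) * q)) =
        th^-1 * E + M%:R ^+ (d - k) * (1 - p) * q.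
      rewrite -thE -{1}(subnK hk) exprD exprVn; field.
      by rewrite expf_eq0 gt_eqF ?andbF.
    rewrite /c; field; by rewrite gt_eqF.
  rewrite mulr_sumr; apply: eq_bigr => T _; rewrite mulrCA; congr *%R.
rewrite (_ : a = fun n => a n)//; under eq_fun do rewrite aE.
apply: cvgD.
  (* The geometric sum is [th / (1 - th) = 1 / (M^(d-k) p - 1)]. *)
  have -> : q * ((M%:R ^+ (d - k) * (1 - p)) / (M%:R ^+ (d - k) * p - 1)) =
      c * (th / (1 - th)).
    rewrite thE /c; field; rewrite !gt_eqF ?subr_gt0//.
  apply: cvgMl_tmp; apply: cvg_geometric_series.
  by rewrite ger0_norm ?ltW.
apply: cvg_big; first exact: add_continuous.
move=> T T2; apply: cvgMl_tmp.
by rewrite (cvg_shiftS (fun N => \sum_(1 <= n < N) b T n)); exact: bcvg.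
Qed.
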